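(* Let $\pi\colon X\to Y$ be a finite abelian cover between compact complex manifolds with Galois group $G$, and let $m\ge1$. Assume that the $m$-canonical map $\Phi_m$ of $X$ is birational. Then for every $h\in G\setminus\{1_G\}$ there exist irreducible constituents $\chi,\chi'$ of the character $\chi_m$ of the $m$-canonical representation $\rho_m$ of $\pi$ such that $\chi(h)\ne\chi'(h)$.
   Context: A finite abelian cover $\pi\colon X\to Y$ with Galois group $G$ is a finite morphism which is the quotient by a faithful action of the finite abelian group $G$ on $X$; $X$ and $Y$ are connected. The $m$-canonical map is $\Phi_m\colon X\dashrightarrow\mathbb{P}(H^0(X,K_X^{\otimes m})^\vee)$, defined by the complete linear system $|K_X^{\otimes m}|$; birational means birational (bimeromorphic) onto its image. The $m$-canonical representation is $\rho_m\colon G\to\operatorname{GL}(H^0(X,K_X^{\otimes m}))$, $\rho_m(g)(\omega)=g^*\omega$, with character $\chi_m$. *)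

(* Defs.v *)
From HB Require Import structures.
From mathcomp Require Import all_boot all_order all_algebra all_fingroup.
From mathcomp Require Import mxrepresentation complex.
From mathcomp Require Import all_classical all_reals all_analysis.

Set Implicit Arguments.
Unset Strict Implicit.
Unset Printing Implicit Defensive.

Import Order.TTheory GRing.Theory Num.Theory numFieldNormedType.Exports.

Local Open Scope classical_set_scope.
Local Open Scope ring_scope.

(* The complex numbers R[i].  Packaging them as a numClosedFieldType makes the
   topology and norm of a numClosedFieldType and of its matrices available. *)
Definition Cx (R : realType) : numClosedFieldType := complex R.

Fixpoint differentiable_upto (K : numFieldType) (V W : normedModType K)
    (k : nat) (U : set V) (f : V -> W) : Prop :=
  (forall z, U z -> differentiable f z) /\
  match k with
  | 0%N => True
  | k'.+1 => forall v : V, differentiable_upto k' U ('D_v f)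
  end.

(* Only used for open U in C^n.  [differentiable] is Frechet differentiability
   over the base field, hence complex differentiability here.  By Cauchy's
   theory, one complex derivative at every point of U (the case k = 0) already
   implies all the others. *)
Definition holomorphic (R : realType) (V W : normedModType (Cx R))
    (U : set V) (f : V -> W) : Prop :=
  forall k, differentiable_upto k U f.

(* [chart] and [chart_inv] are total functions, meaningful only on
   [chart_dom i] and on its image.  The choice of a chart [chart_at x] around
   each point x only serves to evaluate chart-independent expressions. *)
Record complex_atlas (R : realType) (n : nat) (X : topologicalType) :=
  ComplexAtlas {
  chart_index : Type;
  chart_dom : chart_index -> set X;
  chart : chart_index -> X -> 'rV[Cx R]_n;
  chart_inv : chart_index -> 'rV[Cx R]_n -> X;
  chart_at : X -> chart_index;
  chart_dom_open : forall i, open (chart_dom i);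
  chart_img_open : forall i, open (chart i @` chart_dom i);
  chartK : forall i x, chart_dom i x -> chart_inv i (chart i x) = x;
  chart_continuous : forall i, {within chart_dom i, continuous (chart i)};
  chart_inv_continuous : forall i,
    {within chart i @` chart_dom i, continuous (chart_inv i)};
  chart_atP : forall x, chart_dom (chart_at x) x;
  chart_transition : forall i j,
    holomorphic (chart i @` (chart_dom i `&` chart_dom j))
                (chart j \o chart_inv i)
}.

(* With a complex atlas, X is a compact connected complex manifold (second
   countability follows from compactness). *)
Definition compact_connected (X : topologicalType) : Prop :=
  [/\ hausdorff_space X, compact [set: X], connected [set: X]
    & [set: X] !=set0].

Definition holomorphic_fun (R : realType) n (X : topologicalType)
    (M : complex_atlas R n X) (V : set X) (f : X -> Cx R) : Prop :=
  forall i, holomorphic (chart i @` (chart_dom i `&` V))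
                        (f \o chart_inv (c := M) i).

Definition holomorphic_map (R : realType) n p (X Y : topologicalType)
    (MX : complex_atlas R n X) (MY : complex_atlas R p Y) (f : X -> Y) : Prop :=
  continuous f /\
  forall (i : chart_index MX) (j : chart_index MY),
    holomorphic (chart i @` (chart_dom i `&` f @^-1` chart_dom j))
                (chart j \o f \o chart_inv i).

Section Cover.
Context (R : realType) (n p : nat) (X Y : topologicalType).
Context (MX : complex_atlas R n X) (MY : complex_atlas R p Y).
Context (gT : finGroupType) (to : {action gT &-> X}) (pi : X -> Y).

Definition faithful_holomorphic_action : Prop :=
  (forall g, holomorphic_map MX MX (fun x => to x g)) /\
  (forall g, (forall x, to x g = x) -> g = 1%g).

Definition finite_morphism : Prop :=
  [/\ holomorphic_map MX MY pi,
      forall F : set X, closed F -> closed (pi @` F)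
    & forall y, finite_set (pi @^-1` [set y])].

(* Y is the quotient X / G as a space of orbits, as a topological space, and
   as a ringed space: O_Y = (pi_* O_X)^G. *)
Definition is_quotient : Prop :=
  [/\ forall y, exists x, pi x = y,
      forall x x', pi x = pi x' <-> exists g, x' = to x g,
      forall V : set Y, open V <-> open (pi @^-1` V)
    & forall (V : set Y) (f : Y -> Cx R), open V ->
        (holomorphic_fun MY V f <->
         holomorphic_fun MX (pi @^-1` V) (f \o pi))].

Definition finite_abelian_cover : Prop :=
  [/\ abelian [set: gT]%SET, faithful_holomorphic_action, finite_morphism
    & is_quotient].

End Cover.

Section LinearAlgebra.
Context (F : fieldType) (V : lmodType F).

Definition is_basis (P : set V) (N : nat) (e : 'I_N -> V) : Prop :=
  (forall k, P (e k)) /\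
  (forall v, P v -> exists! c : 'rV[F]_N, v = \sum_k c 0 k *: e k).

(* Trace of the endomorphism of the finite-dimensional subspace P induced by f.
   The set below has at most one element; it is empty if P is not
   finite-dimensional or not stable under f, and the value is then 0. *)
Definition trace_on (P : set V) (f : V -> V) : F :=
  xget 0 [set t | exists N (e : 'I_N -> V) (A : 'M[F]_N),
    [/\ is_basis P e, forall j, f (e j) = \sum_i A i j *: e i & t = \tr A]].

End LinearAlgebra.

Section Pluricanonical.
Context (R : realType) (n : nat) (X : topologicalType).
Context (M : complex_atlas R n X).
Local Notation C := (Cx R).

Definition jacobian_det (i j : chart_index M) (f : X -> X) (x : X) : C :=
  \det (jacobian (chart j \o f \o chart_inv i) (chart i x)).

(* A section of K_X^m is given by its coefficients: on the domain of the chart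
   i, with coordinates z, it is  s i * (dz_1 /\ ... /\ dz_n)^m.  The first
   clause makes equality of coefficients the same as equality of sections. *)
Definition local_coefs : Type := chart_index M -> X -> C.

Definition H0 (m : nat) : set local_coefs := [set s : local_coefs |
  [/\ forall i x, ~ chart_dom i x -> s i x = 0,
      forall i, holomorphic (chart i @` chart_dom i) (s i \o chart_inv i)
    & forall i j x, chart_dom i x -> chart_dom j x ->
        s i x = s j x * jacobian_det i j id x ^+ m]].

Definition pullback (m : nat) (f : X -> X) (s : local_coefs) : local_coefs :=
  fun i x =>
    if `[< chart_dom i x >] then
      s (chart_at M (f x)) (f x) * jacobian_det i (chart_at M (f x)) f x ^+ m
    else 0.

Definition mcanonical_rep (m : nat) (gT : finGroupType)
    (to : {action gT &-> X}) (g : gT) : local_coefs -> local_coefs :=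
  pullback m (fun x => to x g).

Definition mcanonical_char (m : nat) (gT : finGroupType)
    (to : {action gT &-> X}) (g : gT) : C :=
  trace_on (V := chart_index M -> X -> C) (H0 m) (mcanonical_rep m to g).

(* U is meant to be open; then S is closed in U. *)
Definition analytic_in (k : nat) (U S : set 'rV[C]_k) : Prop :=
  S `<=` U /\
  forall z, U z -> exists (W : set 'rV[C]_k) (q : nat) (f : 'rV[C]_k -> 'rV[C]_q),
    [/\ open W, W z, W `<=` U, holomorphic W f
      & S `&` W = [set w | W w /\ f w = 0]].

Definition analytic_subset (A : set X) : Prop :=
  forall i : chart_index M,
    analytic_in (chart i @` chart_dom i) (chart i @` (chart_dom i `&` A)).

(* Projective (N-1)-space is handled through homogeneous coordinates: its
   subsets are the subsets of C^N \ {0} stable under nonzero scalars. *)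
Definition conic (N : nat) (B : set 'rV[C]_N) : Prop :=
  forall (c : C) v, c != 0 -> B v -> B (c *: v).

Section Map.
Context (N : nat) (e : 'I_N -> local_coefs).

(* Homogeneous coordinates of the image of x under the map defined by the
   sections e_k; another chart around x rescales this vector. *)
Definition homog_coords (x : X) : 'rV[C]_N := \row_k e k (chart_at M x) x.

Definition base_locus : set X := [set x | homog_coords x = 0].

Definition image_cone (D : set X) : set 'rV[C]_N :=
  [set v | exists (c : C) x, [/\ c != 0, D x & v = c *: homog_coords x]].

Definition closed_image : set 'rV[C]_N :=
  closure (image_cone (~` base_locus)) `\ 0.

(* A map on a locally closed analytic set D is holomorphic if it locally
   extends, in charts of X, to a holomorphic map on an open set. *)
Definition holomorphic_into (D : set 'rV[C]_N) (g : 'rV[C]_N -> X) : Prop :=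
  forall v, D v -> forall i : chart_index M, chart_dom i (g v) ->
    exists (W : set 'rV[C]_N) (h : 'rV[C]_N -> 'rV[C]_n),
      [/\ open W, W v, holomorphic W h
        & forall w, D w -> W w -> chart_dom i (g w) /\ chart i (g w) = h w].

(* The map restricts to a biholomorphism, with inverse g, from X \ A onto
   Z \ B, where Z is the (closed) image and A, B are nowhere dense closed
   analytic subsets of X and Z. *)
Definition birational_onto_image : Prop :=
  exists (A : set X) (B : set 'rV[C]_N) (g : 'rV[C]_N -> X),
  [/\ [/\ analytic_subset A, dense (~` A) & base_locus `<=` A],
      [/\ analytic_in [set~ 0] B, conic B
        & closed_image `<=` closure (closed_image `\` B)],
      image_cone (~` A) = closed_image `\` B,
      holomorphic_into (closed_image `\` B) g
    & forall (c : C) x, c != 0 -> ~ A x -> g (c *: homog_coords x) = x].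

End Map.

(* The dual projective space of H^0(X, K_X^m) is given coordinates by a basis of H^0.  Such
   a basis exists as X is compact, and the choice of it is irrelevant. *)
Definition mcanonical_map_birational (m : nat) : Prop :=
  exists (N : nat) (e : 'I_N -> local_coefs),
    is_basis (V := chart_index M -> X -> C) (H0 m) e /\
    birational_onto_image e.

End Pluricanonical.

Section Characters.
Context (R : realType) (gT : finGroupType).
Local Notation C := (Cx R).

Definition irreducible_char (chi : gT -> C) : Prop :=
  exists (d : nat) (rG : mx_representation C [set: gT]%G d),
    mx_irreducible rG /\ forall g, chi g = \tr (rG g).

Definition char_dot (phi psi : gT -> C) : C :=
  (#|gT|%:R)^-1 * \sum_g phi g * Num.conj (psi g).

Definition irr_constituent (phi chi : gT -> C) : Prop :=
  irreducible_char chi /\ char_dot phi chi != 0.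

End Characters.

(* Main.v *)
(* The group G acts linearly on H^0(X, K_X^m), and since it is abelian this
   action is simultaneously diagonalizable.  If all the constituents of its
   character took the same value c at h, then h would act on H^0(X, K_X^m) as
   the scalar c, so that x and hx would have proportional homogeneous
   coordinates under the m-canonical map.  As that map is injective on a dense
   open set U of X, h would fix every point of the intersection of U with
   h^-1(U), which is dense; hence h would be the identity, against
   faithfulness. *)

Require Import Defs.
From HB Require Import structures.
From mathcomp Require Import all_boot all_order all_algebra all_fingroup.
From mathcomp Require Import mxrepresentation complex.
From mathcomp Require Import all_classical all_reals all_analysis.
From mathcomp Require Import mxpoly separable cyclotomic.

Set Implicit Arguments.
Unset Strict Implicit.
Unset Printing Implicit Defensive.

Import Order.TTheory GRing.Theory Num.Theory numFieldNormedType.Exports.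

Local Open Scope classical_set_scope.
Local Open Scope ring_scope.

(** * Calculus of iterated derivatives *)

Section Calculus.
Context (K : numFieldType).

(** The first-order expansion at [x] involves only the germ of the function, so the differential of
    [f] also serves for [g]. *)
Lemma near_eq_differentiable (V W : normedModType K) (f g : V -> W) (x : V) :
  {near x, f =1 g} -> differentiable f x -> differentiable g x.
Proof.
move=> fg df; have fgx : f x = g x := nbhs_singleton fg.
have /diff_locallyP[dfc dfo] := df.
suff E : g \o shift x = cst (g x) + 'd f x +o_0 id.
  by have dg := diff_unique dfc E; apply/diff_locallyP; rewrite dg.
apply/eqaddoP => e e0.
have /eqaddoP /(_ e e0) fo := dfo.
have : {near x, f =1 g} := fg; rewrite (near_shift 0 x) subr0 => fg0.
near=> y.
have fgy : f (y + x) = g (y + x) by near: y.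
have : `|(f \o shift x - (cst (f x) + 'd f x)) y| <= e * `|y| by near: y.
by rewrite !fctE /= fgy fgx.
Unshelve. all: end_near. Qed.

Lemma derive_coord (V : normedModType K) (m n : nat) (f : V -> 'M[K]_(m, n))
    (x v : V) i j : differentiable f x ->
  'D_v (fun y => f y i j) x = ('D_v f x) i j.
Proof.
move=> df.
have @c : {linear 'M[K]_(m, n) -> K}.
  by exists (fun N : 'M[K]_(_, _) => N i j); do 2![eexists]; do ?[constructor];
     rewrite ?mxE// => ? *; rewrite ?mxE//; move=> ?; rewrite !mxE.
have cc : continuous c by exact: coord_continuous.
have dc : differentiable c (f x) by exact: linear_differentiable.
have -> : (fun y => f y i j) = c \o f by [].
rewrite !deriveE //; last exact: differentiable_comp.
by rewrite (diff_comp df dc) [LHS]/comp (diff_lin _ cc).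
Qed.

Lemma derive_comp_row (V W : normedModType K) n
    (h : V -> 'rV[K]_n) (f : 'rV[K]_n -> W) (x v : V) :
  differentiable h x -> differentiable f (h x) ->
  'D_v (f \o h) x = \sum_i ('D_v h x) 0 i *: 'D_(delta_mx 0 i) f (h x).
Proof.
move=> dh df; rewrite !deriveE //; last exact: differentiable_comp.
rewrite diff_comp //= [in LHS](row_sum_delta ('d h x v)) linear_sum.
by apply: eq_bigr => i _; rewrite linearZ deriveE.
Qed.

Section Upto.
Context (V W : normedModType K).
Implicit Types (U : set V) (f g : V -> W).

Lemma differentiable_uptoW k U f z :
  differentiable_upto k U f -> U z -> differentiable f z.
Proof. by case: k => [|k] [df _] Uz; exact: (df _ Uz). Qed.

Lemma differentiable_upto_leS k U f :
  differentiable_upto k.+1 U f -> differentiable_upto k U f.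
Proof.
elim: k f => [|k IH] f [df Df]; first by split.
by split=> // v; apply: IH; exact: Df.
Qed.

(** All the conditions are pointwise conditions on a total function, so they can be checked on sets
    that vary with the point. In [pullback_H0] this lets the target chart depend on the point. *)
Lemma differentiable_upto_local k U f :
  (forall z, U z -> exists2 U', U' z & differentiable_upto k U' f) ->
  differentiable_upto k U f.
Proof.
elim: k f => [|k IH] f lf; split=> //.
- by move=> z Uz; have [U' U'z [df _]] := lf _ Uz; exact: (df _ U'z).
- by move=> z Uz; have [U' U'z [df _]] := lf _ Uz; exact: (df _ U'z).
- move=> v; apply: IH => z /lf[U' U'z [_ Df]].
  by exists U' => //; exact: (Df v).
Qed.

(** As [U] is open, agreement on [U] is agreement near each of its points; hence the derivatives
    agree on [U] too and the induction goes on. *)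
Lemma differentiable_upto_eq k U f g : open U -> {in U, f =1 g} ->
  differentiable_upto k U f -> differentiable_upto k U g.
Proof.
move=> Uo; elim: k f g => [|k IH] f g fg [df Df].
all: have near_fg z : U z -> {near z, f =1 g}
  by move=> Uz; near=> y; apply: fg; rewrite inE; near: y;
    exact: open_nbhs_nbhs.
all: split=> //; try by move=> z Uz; apply: near_eq_differentiable (df _ Uz);
  exact: near_fg.
move=> v; apply: IH (Df v) => z /set_mem Uz.
exact/near_eq_derive/near_fg.
Unshelve. all: end_near. Qed.

Lemma differentiable_upto_cst k U (a : W) : differentiable_upto k U (cst a).
Proof.
elim: k a => [|k IH] a; split=> // v.
by have -> : 'D_v (cst a) = cst 0 by apply/funext => z; exact: derive_cst.
Qed.

Lemma differentiable_uptoD k U f g : open U ->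
  differentiable_upto k U f -> differentiable_upto k U g ->
  differentiable_upto k U (f + g).
Proof.
move=> Uo; elim: k f g => [|k IH] f g [df Df] [dg Dg].
all: split=> //; try by move=> z Uz;
  exact: (differentiableD (df _ Uz) (dg _ Uz)).
move=> v; apply: differentiable_upto_eq (IH _ _ (Df v) (Dg v)) => //.
move=> z /set_mem Uz; have dfv := diff_derivable (v := v) (df _ Uz).
by rewrite (deriveD dfv (diff_derivable (v := v) (dg _ Uz))).
Qed.

Lemma differentiable_upto_sum k U (I : Type) (r : seq I) (F : I -> V -> W) :
  open U -> (forall i, differentiable_upto k U (F i)) ->
  differentiable_upto k U (\sum_(i <- r) F i).
Proof.
move=> Uo dF; elim/big_ind: _ => //; first exact: differentiable_upto_cst.
by move=> f g; exact: differentiable_uptoD.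
Qed.

End Upto.

Section Scalar.
Context (V : normedModType K).
Implicit Types (U : set V) (f g : V -> K).

(** By the Leibniz rule the derivative is a sum of products of one factor and the derivative of the
    other. The underived factor is lowered by one order to meet the induction hypothesis. *)
Lemma differentiable_uptoM k U f g : open U ->
  differentiable_upto k U f -> differentiable_upto k U g ->
  differentiable_upto k U (f * g).
Proof.
move=> Uo; elim: k f g => [|k IH] f g dkf dkg.
all: have [df Df] := dkf; have [dg Dg] := dkg.
all: split=> //; try by move=> z Uz;
  exact: (differentiableM (df _ Uz) (dg _ Uz)).
move=> v.
apply: (@differentiable_upto_eq _ _ _ _ (f * 'D_v g + g * 'D_v f)) => //.
  move=> z /set_mem Uz; have dfv := diff_derivable (v := v) (df _ Uz).
  by rewrite (deriveM dfv (diff_derivable (v := v) (dg _ Uz))).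
apply: differentiable_uptoD => //.
  by apply: IH (differentiable_upto_leS dkf) (Dg v).
by apply: IH (differentiable_upto_leS dkg) (Df v).
Qed.

Lemma differentiable_upto_prod k U (I : Type) (r : seq I) (F : I -> V -> K) :
  open U -> (forall i, differentiable_upto k U (F i)) ->
  differentiable_upto k U (\prod_(i <- r) F i).
Proof.
move=> Uo dF; elim/big_ind: _ => //; first exact: differentiable_upto_cst.
by move=> f g; exact: differentiable_uptoM.
Qed.

Lemma differentiable_uptoX k U f n : open U ->
  differentiable_upto k U f -> differentiable_upto k U (f ^+ n).
Proof.
move=> Uo df; elim: n => [|n IH]; first exact: differentiable_upto_cst.
by rewrite exprS; exact: differentiable_uptoM.
Qed.

Lemma differentiable_upto_coord k U m n (h : V -> 'M[K]_(m, n)) i j : open U ->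
  differentiable_upto k U h -> differentiable_upto k U (fun z => h z i j).
Proof.
move=> Uo; elim: k h => [|k IH] h [dh Dh].
all: have dhij z : U z -> differentiable (fun y => h y i j) z
  by move=> Uz;
    exact: (differentiable_comp (dh _ Uz) (differentiable_coord _ i j)).
  by split.
split=> // v; apply: differentiable_upto_eq (IH _ (Dh v)) => // z /set_mem Uz.
by rewrite derive_coord //; exact: (dh _ Uz).
Qed.

(** The chain rule in coordinates writes a derivative of [f \o h] as a sum of products of
    coordinates of a derivative of [h] with partial derivatives of [f] composed with [h]; induction
    applies to the latter. *)
Lemma differentiable_upto_comp k U n (U' : set 'rV[K]_n) (h : V -> 'rV[K]_n)
    (f : 'rV[K]_n -> K) : open U -> {homo h : z / U z >-> U' z} ->
  differentiable_upto k U h -> differentiable_upto k U' f ->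
  differentiable_upto k U (f \o h).
Proof.
move=> Uo hU; elim: k f => [|k IH] f dkh dkf.
all: have [dh Dh] := dkh; have [df Df] := dkf.
all: have dfh z : U z -> differentiable (f \o h) z
  by move=> Uz; exact: (differentiable_comp (dh _ Uz) (df _ (hU _ Uz))).
  by split.
split=> // v; have dh' := differentiable_upto_leS dkh.
apply: (@differentiable_upto_eq _ _ _ _ (\sum_i
    ((fun z => 'D_v h z 0 i) * ('D_(delta_mx 0 i) f \o h)))) => //.
  move=> z /set_mem Uz; rewrite (derive_comp_row _ (dh _ Uz) (df _ (hU _ Uz))).
  by rewrite fct_sumE.
apply: differentiable_upto_sum => // i; apply: differentiable_uptoM => //.
  exact: (differentiable_upto_coord _ _ Uo (Dh v)).
exact: (IH _ dh' (Df _)).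
Qed.

End Scalar.

Section Jacobian.
Context (m n : nat).
Implicit Types (F : 'rV[K]_m -> 'rV[K]_n).

Lemma jacobianE F z i j : differentiable F z ->
  jacobian F z i j = 'D_(delta_mx 0 i) F z 0 j.
Proof. by move=> dF; rewrite deriveEjacobian // -rowE [RHS]mxE. Qed.

Lemma near_eq_jacobian F G z : {near z, F =1 G} -> differentiable F z ->
  jacobian F z = jacobian G z.
Proof.
move=> FG dF; have dG := near_eq_differentiable FG dF.
apply/matrixP => i j.
apply: (etrans (jacobianE i j dF)); apply: (etrans _ (esym (jacobianE i j dG))).
by rewrite (near_eq_derive _ FG).
Qed.

Lemma jacobian_comp p F (G : 'rV[K]_n -> 'rV[K]_p) z :
  differentiable F z -> differentiable G (F z) ->
  jacobian (G \o F) z = jacobian F z *m jacobian G (F z).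
Proof.
move=> dF dG; apply/row_matrixP => i; rewrite row_mul !rowE.
rewrite /jacobian (mul_rV_lin1 ('d (G \o F) z)) (diff_comp dF dG).
by rewrite (mul_rV_lin1 ('d F z)) (mul_rV_lin1 ('d G (F z))).
Qed.

End Jacobian.

(** The permutation expansion of the determinant is a polynomial in the first partial derivatives,
    which costs one order of differentiability. *)
Lemma differentiable_upto_jacobian_det k n (U : set 'rV[K]_n)
    (F : 'rV[K]_n -> 'rV[K]_n) : open U -> differentiable_upto k.+1 U F ->
  differentiable_upto k U (fun z => \det (jacobian F z)).
Proof.
move=> Uo [dF DF].
apply: (differentiable_upto_eq (f := \sum_(s : 'S_n) (cst ((-1) ^+ s) *
    \prod_i (fun z => 'D_(delta_mx 0 i) F z 0 (s i))))) => //.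
  move=> z /set_mem Uz; rewrite fct_sumE; apply: eq_bigr => s _.
  rewrite /GRing.mul /= fct_prodE; congr (_ * _); apply: eq_bigr => i _.
  exact: (esym (jacobianE _ _ (dF _ Uz))).
apply: differentiable_upto_sum => // s; apply: differentiable_uptoM => //.
  exact: differentiable_upto_cst.
by apply: differentiable_upto_prod => // i;
  exact: (differentiable_upto_coord _ _ Uo (DF _)).
Qed.

End Calculus.

(** * Pullback of pluricanonical sections *)

Lemma open_setI_preimage (T U : topologicalType) (D : set T) (f : T -> U)
    (A : set U) : open D -> {within D, continuous f} -> open A ->
  open (D `&` f @^-1` A).
Proof.
move=> Do; rewrite continuous_open_subspace // => fc Ao.
rewrite openE => x [Dx Afx]; apply: filterI; first exact: open_nbhs_nbhs.
by apply: fc; [rewrite inE|exact: open_nbhs_nbhs].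
Qed.

Section Charts.
Context (R : realType) (n : nat) (X : topologicalType).
Context (M : complex_atlas R n X).
Implicit Types (i j k : chart_index M) (A : set X).

(** Turning the image into a preimage under [chart_inv] makes its openness a consequence of the
    continuity of [chart_inv]. *)
Lemma chart_imageE i A : chart i @` (chart_dom i `&` A) =
  chart i @` chart_dom i `&` chart_inv i @^-1` A.
Proof.
apply/seteqP; split => [_ [x [ix Ax] <-]|_ [[x ix <-]]].
  by split; [exists x|rewrite /= chartK].
by rewrite /= chartK // => Ax; exists x.
Qed.

Lemma open_chart_image i A : open A -> open (chart i @` (chart_dom i `&` A)).
Proof.
move=> Ao; rewrite chart_imageE; apply: open_setI_preimage => //.
  exact: chart_img_open.
exact: chart_inv_continuous.
Qed.

Lemma holomorphic_map_id : holomorphic_map M M id.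
Proof. by split=> [x|]; [exact: cvg_id|exact: chart_transition]. Qed.

Section HolomorphicMap.
Context (f : X -> X) (holo_f : holomorphic_map M M f).

Lemma open_chart_preimage i j :
  open (chart i @` (chart_dom i `&` f @^-1` chart_dom j)).
Proof.
apply: open_chart_image; apply: open_comp => [x _|]; last exact: chart_dom_open.
exact: holo_f.1.
Qed.

Lemma differentiable_local_rep i j x : chart_dom i x -> chart_dom j (f x) ->
  differentiable (chart j \o f \o chart_inv i) (chart i x).
Proof.
move=> ix jfx; apply: differentiable_uptoW (holo_f.2 i j 0%N) _.
by exists x.
Qed.

End HolomorphicMap.

(** The cocycle rule: the two local representatives agree only near [chart i x], where [f] stays in
    the chart [j], but the Jacobian sees only this germ. With [f] or [g] equal to [id] it gives the
    effect of a change of chart. *)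
Lemma jacobian_det_comp (f g : X -> X) i j k x :
    holomorphic_map M M f -> holomorphic_map M M g ->
    chart_dom i x -> chart_dom j (f x) -> chart_dom k (g (f x)) ->
  jacobian_det i k (g \o f) x = jacobian_det i j f x * jacobian_det j k g (f x).
Proof.
move=> hf hg ix jfx kgfx.
pose F := chart j \o f \o chart_inv i; pose G := chart k \o g \o chart_inv j.
have Fx : F (chart i x) = chart j (f x) by rewrite /F /= chartK.
have dF : differentiable F (chart i x) by exact: differentiable_local_rep.
have dG : differentiable G (F (chart i x)).
  by rewrite Fx; exact: differentiable_local_rep.
have GF : {near chart i x, G \o F =1 chart k \o (g \o f) \o chart_inv i}.
  near=> z.
  have [y [iy jfy] <-] :
      (chart i @` (chart_dom i `&` f @^-1` chart_dom j)) z.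
    near: z; apply: open_nbhs_nbhs; split; last by exists x.
    exact: open_chart_preimage.
  by rewrite /G /F /= !chartK.
rewrite /jacobian_det -(near_eq_jacobian GF (differentiable_comp dF dG)).
by rewrite (jacobian_comp dF dG) det_mulmx Fx.
Unshelve. all: end_near. Qed.

End Charts.

Section Pullback.
Context (R : realType) (n : nat) (X : topologicalType).
Context (M : complex_atlas R n X) (m : nat).
Implicit Types (i j : chart_index M) (s : local_coefs M) (f g : X -> X).

Lemma pullback_dom f s i x : chart_dom i x -> pullback m f s i x =
  s (chart_at M (f x)) (f x) * jacobian_det i (chart_at M (f x)) f x ^+ m.
Proof. by rewrite /pullback; case: asboolP. Qed.

Lemma pullback_ndom f s i x : ~ chart_dom i x -> pullback m f s i x = 0.
Proof. by rewrite /pullback; case: asboolP. Qed.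

(** The chart chosen at [f x] in the definition of [pullback] may be replaced by any other: the
    transition factor of [s] is absorbed by the cocycle rule. *)
Lemma pullbackE f s i j x : holomorphic_map M M f -> H0 m s ->
    chart_dom i x -> chart_dom j (f x) ->
  pullback m f s i x = s j (f x) * jacobian_det i j f x ^+ m.
Proof.
move=> hf [_ _ sJ] ix jfx; rewrite (pullback_dom _ _ ix).
have -> : jacobian_det i j f x = jacobian_det i (chart_at M (f x)) f x *
    jacobian_det (chart_at M (f x)) j id (f x).
  exact: (jacobian_det_comp (g := id) hf (holomorphic_map_id M) ix
    (chart_atP M _)).
by rewrite exprMn mulrA mulrAC -(sJ _ _ _ (chart_atP M (f x)) jfx).
Qed.

Lemma pullback_H0 f s :
  holomorphic_map M M f -> H0 m s -> H0 m (pullback m f s).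
Proof.
move=> hf Hs; have [_ holo_s _] := Hs.
split=> [i x nix|i d|i j x ix jx]; first exact: pullback_ndom.
  apply: differentiable_upto_local => _ [x ix <-].
  set j := chart_at M (f x).
  have jfx : chart_dom j (f x) by exact: chart_atP.
  pose F := chart j \o f \o chart_inv i.
  (* On this neighbourhood [f] lands in the single chart [j], so the pullback has one formula there,
     whereas [chart_at] may jump from point to point. *)
  have Uo : open (chart i @` (chart_dom i `&` f @^-1` chart_dom j)).
    exact: open_chart_preimage.
  exists (chart i @` (chart_dom i `&` f @^-1` chart_dom j)); first by exists x.
  apply: (differentiable_upto_eq (f := ((s j \o chart_inv j) \o F) *
    (fun z => \det (jacobian F z)) ^+ m)) => //.
    move=> _ /set_mem [y [iy jfy] <-].
    rewrite /= chartK // (pullbackE hf Hs iy jfy).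
    by rewrite mulrfctE exprfctE /F /= !chartK.
  apply: differentiable_uptoM => //.
    apply: differentiable_upto_comp (hf.2 i j d) (holo_s j d) => //.
    by move=> _ [y [iy jfy] <-]; exists (f y) => //; rewrite /F /= chartK.
  apply: differentiable_uptoX => //.
  (* Order [d.+1] is requested because the Jacobian loses one order. *)
  exact/differentiable_upto_jacobian_det/(hf.2 i j d.+1).
(* For the transition law, both coefficients are computed in the same chart at [f x]; the cocycle
   rule for [f \o id] then compares the charts [i] and [j] at [x]. *)
have kfx := chart_atP M (f x).
rewrite (pullbackE hf Hs ix kfx) (pullbackE hf Hs jx kfx) -mulrA -exprMn.
congr (_ * _ ^+ m); rewrite mulrC.
exact: (jacobian_det_comp (f := id) (holomorphic_map_id M) hf ix jx kfx).
Qed.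

Lemma pullback_comp f g s : holomorphic_map M M f -> holomorphic_map M M g ->
  pullback m f (pullback m g s) = pullback m (g \o f) s.
Proof.
move=> hf hg; apply/funext => i; apply/funext => x.
have [ix|nix] := pselect (chart_dom i x); last first.
  by rewrite !(pullback_ndom _ _ nix).
have kfx := chart_atP M (f x); have lgfx := chart_atP M (g (f x)).
rewrite (pullback_dom _ _ ix) (pullback_dom _ _ kfx) (pullback_dom _ _ ix).
rewrite (jacobian_det_comp hf hg ix kfx lgfx) exprMn -mulrA.
by rewrite [X in _ * X = _]mulrC.
Qed.

Lemma pullback_id s : H0 m s -> pullback m id s = s.
Proof.
move=> Hs; have [s0 _ sJ] := Hs; apply/funext => i; apply/funext => x.
have [ix|nix] := pselect (chart_dom i x).
  rewrite (pullback_dom _ _ ix); exact/esym/(sJ _ _ _ ix (chart_atP M x)).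
by rewrite (s0 _ _ nix) (pullback_ndom _ _ nix).
Qed.

Lemma coefs_sumE (N : nat) (c : 'I_N -> Cx R) (e : 'I_N -> local_coefs M) i x :
  (\sum_l c l *: (e l : chart_index M -> X -> Cx R)) i x = \sum_l c l * e l i x.
Proof. by rewrite fct_sumE fct_sumE. Qed.

Lemma pullback_sum f (N : nat) (c : 'I_N -> Cx R) (e : 'I_N -> local_coefs M) :
  pullback m f (\sum_l c l *: (e l : chart_index M -> X -> Cx R)) =
  \sum_l c l *: (pullback m f (e l) : chart_index M -> X -> Cx R).
Proof.
apply/funext => i; apply/funext => x; rewrite [RHS]coefs_sumE /pullback.
case: (asboolP (chart_dom i x)) => ix; last first.
  by rewrite big1 // => l _; rewrite mulr0.
by rewrite coefs_sumE mulr_suml; apply: eq_bigr => l _; rewrite mulrA.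
Qed.

End Pullback.

(** * Bases and diagonalization *)

Section Basis.
Context (F : fieldType) (V : lmodType F) (P : set V) (f : V -> V).
Context (f_stable : forall v, P v -> P (f v)).
Context (f_sum : forall N (c : 'I_N -> F) (e : 'I_N -> V),
  f (\sum_i c i *: e i) = \sum_i c i *: f (e i)).

Lemma basis_coef_inj N (e : 'I_N -> V) (c d : 'I_N -> F) : is_basis P e ->
  P (\sum_i c i *: e i) -> \sum_i c i *: e i = \sum_i d i *: e i -> c =1 d.
Proof.
move=> [_ eP] Pc cd i; have [b [_ uniq_b]] := eP _ Pc.
have bc : b = \row_i c i.
  by apply: uniq_b; apply: eq_bigr => j _; rewrite mxE.
have bd : b = \row_i d i.
  by apply: uniq_b; rewrite cd; apply: eq_bigr => j _; rewrite mxE.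
by have := congr1 (fun r : 'rV_N => r 0 i) (etrans (esym bc) bd); rewrite !mxE.
Qed.

Lemma basis_coefs N (e : 'I_N -> V) N' (u : 'I_N' -> V) : is_basis P e ->
  (forall j, P (u j)) ->
  exists A : 'M[F]_(N, N'), forall j, u j = \sum_i A i j *: e i.
Proof.
move=> [_ eP] Pu.
have /choice[c uc] : forall j, exists c : 'rV[F]_N, u j = \sum_k c 0 k *: e k.
  by move=> j; have [c [uc _]] := eP _ (Pu j); exists c.
exists (\matrix_(i, j) c j 0 i) => j; rewrite [LHS]uc.
by apply: eq_bigr => i _; rewrite mxE.
Qed.

Lemma sum_coefs_mul N p q (e : 'I_N -> V) (A : 'M[F]_(N, p))
    (B : 'M[F]_(p, q)) j :
  \sum_l B l j *: (\sum_i A i l *: e i) = \sum_i (A *m B) i j *: e i.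
Proof.
under eq_bigr do rewrite scaler_sumr.
rewrite exchange_big; apply: eq_bigr => i _.
rewrite mxE scaler_suml; apply: eq_bigr => l _.
by rewrite scalerA mulrC.
Qed.

Lemma sum_scalar_mx N (e : 'I_N -> V) c j :
  \sum_i (c%:M : 'M[F]_N) i j *: e i = c *: e j.
Proof.
rewrite (bigD1 j) //= big1 => [|i /negPf ij]; first by rewrite mxE eqxx addr0.
by rewrite mxE ij scale0r.
Qed.

Lemma basis_mx_inj N N' (e : 'I_N -> V) (u : 'I_N' -> V) (A B : 'M[F]_(N, N')) :
  is_basis P e -> (forall j, P (u j)) ->
  (forall j, u j = \sum_i A i j *: e i) ->
  (forall j, u j = \sum_i B i j *: e i) -> A = B.
Proof.
move=> be Pu uA uB; apply/matrixP => i j.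
apply: (basis_coef_inj (c := A^~ j) (d := B^~ j) be); first by rewrite -uA.
by rewrite -uA -uB.
Qed.

(** The value chosen by [xget] is unique because the trace does not depend on the basis. The base
    changes [S] and [T] are mutually inverse, a priori rectangular, and S A' = A S; so tr A' = tr (T
    A S) = tr (A S T) = tr A, without first comparing [N] and [N']. *)
Lemma trace_onE N (e : 'I_N -> V) (A : 'M[F]_N) : is_basis P e ->
  (forall j, f (e j) = \sum_i A i j *: e i) -> trace_on P f = \tr A.
Proof.
move=> be fe; apply: xget_unique => [|_ [N' [e' [A' [be' fe' ->]]]]].
  by exists N, e, A.
have [S e'S] := basis_coefs be (proj1 be').
have [T eT] := basis_coefs be' (proj1 be).
have ST : S *m T = 1%:M.
  apply: (basis_mx_inj be (proj1 be)) => j; last first.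
    by rewrite sum_scalar_mx scale1r.
  by rewrite -sum_coefs_mul [LHS]eT; apply: eq_bigr => i _; rewrite -e'S.
have TS : T *m S = 1%:M.
  apply: (basis_mx_inj be' (proj1 be')) => j; last first.
    by rewrite sum_scalar_mx scale1r.
  by rewrite -sum_coefs_mul [LHS]e'S; apply: eq_bigr => i _; rewrite -eT.
have SA' : S *m A' = A *m S.
  apply: (basis_mx_inj (u := fun j => f (e' j)) be) => j.
  - by apply: f_stable; exact: (proj1 be').
  - by rewrite fe' -sum_coefs_mul; apply: eq_bigr => i _; rewrite -e'S.
  - rewrite [in LHS]e'S f_sum -sum_coefs_mul; apply: eq_bigr => i _.
    by rewrite fe.
by rewrite -[A']mul1mx -TS -mulmxA SA' mulmxA mxtrace_mulC mulmxA ST mul1mx.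
Qed.

End Basis.

(** * Characters and constituents for a finite abelian group *)

Section Characters.
Context (R : realType) (gT : finGroupType).
Local Notation C := (Cx R).

Lemma multiplicative_irreducible (chi : gT -> C) : chi 1%g = 1 ->
  {morph chi : g h / (g * h)%g >-> g * h} -> irreducible_char chi.
Proof.
move=> chi1 chiM.
have rP : mx_repr [set: gT]%G (fun g => (chi g)%:M : 'M[C]_1).
  by split=> [|g h _ _]; rewrite ?chi1 // chiM scalar_mxM.
exists 1%N, (MxRepresentation rP); split=> [|g]; last by rewrite mxtrace_scalar.
apply/mx_irrP; split=> // U _ U0.
by rewrite row_full_unit unitmxE det_mx11 unitfE; apply: contra_neq U0 => U00;
  apply/matrixP => i j; rewrite !ord1 U00 mxE.
Qed.

(* The sum is fixed under multiplication by any value of a character; so it is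
   0 unless the character is trivial. *)
Lemma sum_multiplicative_ge0 (mu : gT -> C) :
  {morph mu : g h / (g * h)%g >-> g * h} -> 0 <= \sum_g mu g.
Proof.
move=> muM; have [/forallP mu1|] := boolP [forall g, mu g == 1].
  by apply: sumr_ge0 => g _; rewrite (eqP (mu1 g)) ler01.
rewrite negb_forall => /existsP[h muh].
suff : (mu h - 1) * \sum_g mu g = 0.
  by move/eqP; rewrite mulf_eq0 subr_eq0 (negPf muh) => /eqP ->.
rewrite mulrBl mul1r mulr_sumr [X in _ - X](reindex_inj (mulgI h)).
by apply/eqP; rewrite subr_eq0; apply/eqP/eq_bigr => g _; rewrite muM.
Qed.

(** The scalar product with [d ^~ i] is a sum over [j] of nonnegative terms, since each product of
    [d ^~ j] with the conjugate of [d ^~ i] is multiplicative. The term [j = i] is positive: the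
    identity contributes 1 and the other elements squared moduli. Repeated characters thus need no
    separate treatment. *)
Lemma diagonal_irr_constituent n (d : gT -> 'I_n -> C) i :
  (forall j, d 1%g j = 1) ->
  (forall j, {morph d ^~ j : g h / (g * h)%g >-> g * h}) ->
  irr_constituent (fun g => \sum_j d g j) (d ^~ i).
Proof.
move=> d1 dM; split; first exact: multiplicative_irreducible.
rewrite /char_dot mulf_eq0 negb_or invr_eq0 pnatr_eq0 -lt0n.
have -> /= : (0 < #|gT|)%N by apply/card_gt0P; exists 1%g.
under eq_bigr do rewrite mulr_suml.
rewrite exchange_big (bigD1 i) //= gt_eqF // ltr_wpDr //.
  apply: sumr_ge0 => j _; apply: sum_multiplicative_ge0 => g h.
  by rewrite !dM rmorphM mulrACA.
rewrite (bigD1 1%g) //= !d1 rmorph1 mulr1 ltr_wpDr // sumr_ge0 // => g _.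
exact: mul_conjC_ge0.
Qed.

(** The minimal polynomial divides X^k - 1, which splits over the complex numbers and is separable
    in characteristic 0. *)
Lemma diagonalizable_finite_order n (A : 'M[C]_n.+1) k : (0 < k)%N ->
  A ^+ k = 1 -> diagonalizable A.
Proof.
move=> k0 Ak; apply/diagonalizableP.
have [rs rsE] := closed_field_poly_normal ('X^k - 1 : {poly C}).
move: rsE; rewrite lead_coefXnsubC // scale1r => rsE; exists rs.
  rewrite -separable_prod_XsubC -rsE; apply: separable_Xn_sub_1.
  by rewrite pnatr_eq0 -lt0n.
by rewrite -rsE dvd_mxminpoly rmorphB rmorphXn /= horner_mx_X Ak rmorph1 subrr.
Qed.

(** In a common eigenbasis the diagonal entries of [rho] are constituents; if they all agreed at
    [h], then [rho h] would be conjugate to a scalar matrix, hence scalar. *)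
Lemma irr_constituent_separate n (rho : gT -> 'M[C]_n) (h : gT) :
    abelian [set: gT]%SET -> rho 1%g = 1%:M ->
    {morph rho : g g' / (g * g')%g >-> g *m g'} ->
    (forall c, rho h <> c%:M) ->
  exists chi chi', [/\ irr_constituent (fun g => \tr (rho g)) chi,
    irr_constituent (fun g => \tr (rho g)) chi' & chi h <> chi' h].
Proof.
case: n rho => [|n] rho abG rho1 rhoM rhoh.
  (* In size 0 the only matrix is scalar, which the hypothesis on [rho h] excludes. *)
  by case: (rhoh 0); rewrite [RHS]flatmx0 [LHS]flatmx0.
have rhoX g k : rho (g ^+ k)%g = rho g ^+ k.
  by elim: k => [|k IH]; rewrite ?expg0 // expgS rhoM IH exprS.
(* Commuting diagonalizable matrices are simultaneously diagonalizable. *)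
have [] := (codiagonalizableP [seq rho g | g <- enum gT]).1.
  split=> [_ _ /mapP[g _ ->] /mapP[g' _ ->]|_ /mapP[g _ ->]].
    rewrite /comm_mx -!rhoM; congr rho.
    by apply: (centsP abG); rewrite inE.
  apply: (@diagonalizable_finite_order _ _ #[g]%g); first exact: order_gt0.
  by rewrite -rhoX expg_order.
move=> S Su /allP diagS.
pose D g := S *m rho g *m invmx S.
have Doff g i j : i != j -> D g i j = 0.
  have /(diagonalizable_forP _ Su) Dij : diagonalizable_for S (rho g).
    by apply: diagS; rewrite map_f // mem_enum.
  exact: Dij.
have rhoD g : rho g = invmx S *m D g *m S.
  by rewrite /D !mulmxA mulVmx // mul1mx -mulmxA mulVmx // mulmx1.
have trD g : \tr (rho g) = \sum_i D g i i.
  by rewrite rhoD -mulmxA mxtrace_mulC -mulmxA mulmxV // mulmx1.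
have D1 i : D 1%g i i = 1.
  by rewrite /D rho1 mulmx1 mulmxV // mxE eqxx.
have DM g g' : D (g * g')%g = D g *m D g'.
  by rewrite /D rhoM !mulmxA mulmxKV.
clearbody D.
have DMi i : {morph (fun g => D g i i) : g g' / (g * g')%g >-> g * g'}.
  move=> g g'; rewrite DM mxE (bigD1 i) //= big1 ?addr0 // => j ji.
  by rewrite (Doff g) ?mul0r // eq_sym.
have -> : (fun g => \tr (rho g)) = (fun g => \sum_i D g i i) by apply/funext.
have constD i := diagonal_irr_constituent i D1 DMi.
have [/forallP Dh|] := boolP [forall i, D h i i == D h ord0 ord0].
  move: (D h ord0 ord0) Dh => c Dh; case: (rhoh c); rewrite rhoD.
  have -> : D h = c%:M.
    apply/matrixP => i j; rewrite [RHS]mxE.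
    by case: (eqVneq i j) => [<-|ij]; [exact: (eqP (Dh i))|exact: Doff].
  by rewrite -mulmxA -scalar_mxC mulmxA mulVmx // mul1mx.
rewrite negb_forall => /existsP[i /eqP Dhi].
by exists (fun g => D g i i), (fun g => D g ord0 ord0).
Qed.

End Characters.

(** * Geometry of the action *)

Section TotalAction.
Context (gT : finGroupType) (T : Type) (to : {action gT &-> T}).

Lemma total_actM x (a b : gT) : to x (a * b)%g = to (to x a) b.
Proof.
by case: to => f fP /=; have [_ fM] := fP; apply: fM; rewrite finset.in_setT.
Qed.

(** Acting by 1 is idempotent and injective, hence the identity. *)
Lemma total_act1 x : to x 1%g = x.
Proof.
have inj1 : injective (to^~ 1%g) by case: to => f fP; exact: (proj1 fP).
by apply: inj1; rewrite -total_actM mulg1.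
Qed.

End TotalAction.

Section Analytic.
Context (R : realType) (n : nat) (X : topologicalType).
Context (M : complex_atlas R n X).

(** At a point outside [A] the local equations do not all vanish; by continuity they do not all
    vanish nearby, so the complement is open. *)
Lemma analytic_subset_closed (A : set X) : analytic_subset M A -> closed A.
Proof.
move=> anA; rewrite -openC openE => x nAx.
set i := chart_at M x; have ix : chart_dom i x by exact: chart_atP.
have [_ /(_ (chart i x))[]] := anA i; first by exists x.
move=> W [q [f [Wo Wx Wsub holo_f SW]]].
have fx0 : f (chart i x) != 0.
  apply/eqP => fx0; apply: nAx.
  have : (W `&` [set w | f w = 0]) (chart i x) by split.
  rewrite -[_ `&` _]SW => -[[y [iy Ay] yx] _].
  by rewrite -(chartK ix) -yx chartK.
have /open_nbhs_nbhs Wx' : open_nbhs (chart i x) W by [].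
have fc : {for chart i x, continuous f}.
  exact: differentiable_continuous (differentiable_uptoW (holo_f 0%N) Wx).
have nf0 : \forall w \near chart i x, W w /\ f w != 0.
  by apply: filterI => //; exact: (cvgr_neq0 _ fc fx0).
have ic : {for x, continuous (chart i)}.
  have := @chart_continuous _ _ _ M i.
  rewrite continuous_open_subspace; last exact: chart_dom_open.
  by apply; rewrite inE.
near=> y => Ay.
have iy : chart_dom i y.
  by near: y; apply: open_nbhs_nbhs; split=> //; exact: chart_dom_open.
have [Wy /eqP fy] : W (chart i y) /\ f (chart i y) != 0.
  by near: y; exact: (ic _ nf0).
have : (chart i @` (chart_dom i `&` A) `&` W) (chart i y).
  by split=> //; exists y.
by rewrite SW => -[_ /fy].
Unshelve. all: end_near. Qed.

End Analytic.

(** If [f] moves [x], separate [x] and [f x] by [W] and [V]. Density of [U], used once for the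
    source and once for the target, gives a point of [W] in [U] whose image lies in both [V] and
    [U]; it is fixed by [f], hence lies in both [V] and [W]. *)
Lemma eq_id_on_dense_open (X : topologicalType) (U : set X) (f f' : X -> X) :
    hausdorff_space X -> open U -> dense U -> continuous f -> continuous f' ->
    cancel f f' -> cancel f' f ->
    (forall x, U x -> U (f x) -> f x = x) ->
  forall x, f x = x.
Proof.
move=> hX Uo Ud fc fc' fK fK' fU x; apply/eqP/negPn/negP => fxx.
move: hX; rewrite open_hausdorff => /(_ _ _ fxx)[[V W] /= [Vfx Wx] [Vo Wo VW]].
have fo (O : set X) : open O -> open (f @^-1` O).
  by move=> Oo; apply: open_comp => // y _; exact: fc.
pose O := W `&` f @^-1` V `&` U.
have Oo : open O by apply: openI => //; apply: openI => //; exact: fo.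
have [y Oy] : O !=set0.
  apply: Ud; last by apply: openI => //; exact: fo.
  by exists x; split; exact: set_mem.
have [z [Oz Uz]] : (f' @^-1` O) `&` U !=set0.
  apply: Ud; first by exists (f y); rewrite /= fK.
  by apply: open_comp => // ? _; exact: fc'.
have [[Wz Vz] Uz'] : O (f' z) := Oz.
have fz : f (f' z) = f' z by apply: fU; rewrite ?fK'.
have : (V `&` W) (f' z) by split=> //; rewrite -fz.
by rewrite (eqP VW).
Qed.

(** * The m-canonical representation in a basis of sections *)

Section PluricanonicalRep.
Context (R : realType) (n : nat) (X : topologicalType).
Context (M : complex_atlas R n X) (m : nat).
Context (gT : finGroupType) (to : {action gT &-> X}).
Local Notation C := (Cx R).
Context (holo_to : forall g, holomorphic_map M M (fun x => to x g)).
Context (N : nat) (e : 'I_N -> local_coefs M).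
Context (be : is_basis (V := chart_index M -> X -> C) (H0 m) e).

Lemma mcanonical_rep_mx : exists rho : gT -> 'M[C]_N,
  [/\ rho 1%g = 1%:M,
      {morph rho : g h / (g * h)%g >-> g *m h},
      mcanonical_char M m to = fun g => \tr (rho g)
    & forall g j, mcanonical_rep m to g (e j) =
        \sum_i rho g i j *: (e i : chart_index M -> X -> C)].
Proof.
have eH0 := proj1 be.
have stab g (s : local_coefs M) : H0 m s -> H0 m (mcanonical_rep m to g s)
  by move=> Hs; exact: (pullback_H0 (holo_to g) Hs).
have /choice[rho rhoE] : forall g, exists A : 'M[C]_N, forall j,
    mcanonical_rep m to g (e j) =
      \sum_i A i j *: (e i : chart_index M -> X -> C).
  by move=> g; apply: (basis_coefs be) => j; exact: stab.
exists rho; split=> //.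
- apply: (basis_mx_inj be eH0) => j.
    rewrite -rhoE /mcanonical_rep.
    have -> : (fun x => to x 1%g) = id by apply/funext => x; exact: total_act1.
    by rewrite pullback_id.
  apply: esym; apply: (etrans (sum_scalar_mx _ _ _)).
  exact: scale1r.
- move=> g h.
  apply: (basis_mx_inj be (fun j => stab (g * h)%g _ (eH0 j))) => // j.
  (* The action is on the right and pullback reverses composition, so [rho] is a homomorphism and
     not an antihomomorphism. *)
  have toM : (fun x => to x h) \o (fun x => to x g) = (fun x => to x (g * h)%g).
    by apply/funext => x; rewrite /= total_actM.
  transitivity (mcanonical_rep m to g (mcanonical_rep m to h (e j))).
    apply: esym.
    apply: (etrans (pullback_comp _ (e j) (holo_to g) (holo_to h))).
    by rewrite toM.
  rewrite (rhoE h j); apply: (etrans (pullback_sum _ _ _ _)).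
  apply: (etrans _ (sum_coefs_mul (V := chart_index M -> X -> C) _ _ _ _)).
  by apply: eq_bigr => l _; congr (_ *: _); exact: rhoE.
apply/funext => g; apply: (trace_onE (stab g) _ be (rhoE g)).
by move=> N' c u; exact: pullback_sum.
Qed.

(** Evaluating the scalar action at [x] shows that [x] and its image under [g] have proportional
    homogeneous coordinates, and [p] recovers each point outside [A] from any nonzero multiple of
    its coordinates. *)
Lemma scalar_rep_fixes (A : set X) (p : 'rV[C]_N -> X) (g : gT) (c : C) :
  base_locus e `<=` A ->
  (forall (a : C) x, a != 0 -> ~ A x -> p (a *: homog_coords e x) = x) ->
  c != 0 ->
  (forall j, mcanonical_rep m to g (e j) =
    c *: (e j : chart_index M -> X -> C)) ->
  forall x, ~ A x -> ~ A (to x g) -> to x g = x.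
Proof.
move=> baseA pK c0 ge x Ax Agx.
set J := jacobian_det (chart_at M x) (chart_at M (to x g))
  (fun x => to x g) x ^+ m.
have J_coords : J *: homog_coords e (to x g) = c *: homog_coords e x.
  apply/rowP => k; rewrite !mxE.
  have := congr1 (fun s : local_coefs M => s (chart_at M x) x) (ge k).
  by rewrite /mcanonical_rep pullback_dom; [rewrite mulrC|exact: chart_atP].
(* Were the Jacobian factor zero, all coordinates of [x] would vanish, putting [x] in the base
   locus. *)
have J0 : J != 0.
  apply/eqP => J0; apply/Ax/baseA/eqP; move/eqP: J_coords.
  by rewrite J0 scale0r eq_sym scaler_eq0 (negPf c0).
by rewrite -(pK _ _ J0 Agx) J_coords pK.
Qed.

End PluricanonicalRep.

Theorem corollary4p6 (R : realType) (nX nY : nat) (X Y : topologicalType)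
    (MX : complex_atlas R nX X) (MY : complex_atlas R nY Y)
    (gT : finGroupType) (to : {action gT &-> X}) (pi : X -> Y) (m : nat)
    (hX : compact_connected X) (hY : compact_connected Y)
    (hpi : finite_abelian_cover MX MY to pi)
    (hm : (1 <= m)%N)
    (hbir : mcanonical_map_birational MX m) :
  forall h : gT, h != 1%g ->
  exists chi chi' : gT -> Cx R,
    [/\ irr_constituent (mcanonical_char MX m to) chi,
        irr_constituent (mcanonical_char MX m to) chi'
      & chi h <> chi' h].
Proof.
move=> h h1; have [abG [holo_to faithful_to] _ _] := hpi.
have [hausX _ _ [x0 _]] := hX.
have [N [e [be [A [B [p [[anA denseA baseA] _ _ _ pK]]]]]]] := hbir.
have [rho [rho1 rhoM -> rhoE]] := mcanonical_rep_mx holo_to be.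
apply: irr_constituent_separate => // c rhoh.
case/eqP: h1; apply: faithful_to.
have [y [_ Ay]] : [set: X] `&` ~` A !=set0.
  by apply: denseA; [exists x0|exact: openT].
(* If [c] were 0, then [rho h], and with it the identity matrix, would be 0. This is contradictory
   only for [N] positive, so it is applied to the coordinates of [y], a point off the base locus. *)
have c0 : c != 0.
  apply/eqP => c0; apply/Ay/baseA; rewrite /base_locus /=.
  rewrite -[LHS]mulmx1 -rho1 -(mulgV h) rhoM rhoh c0.
  by rewrite (raddf0 scalar_mx) mul0mx mulmx0.
apply: (eq_id_on_dense_open (f' := fun x => to x h^-1%g) hausX _ denseA).
- by rewrite openC; exact: analytic_subset_closed anA.
- exact: (holo_to h).1.
- exact: (holo_to h^-1%g).1.
- by move=> x; rewrite -total_actM mulgV total_act1.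
- by move=> x; rewrite -total_actM mulVg total_act1.
apply: (scalar_rep_fixes (m := m) (to := to) (g := h) baseA pK c0) => j.
by rewrite rhoE rhoh; exact: sum_scalar_mx.
Qed.
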